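(* There are exactly $20$ equivalence classes (under the action of $S_6$ permuting the variables) of square free Cremona sets $F$ of monomials of degree $3$ in $\mathbb{K}[x_1,\ldots,x_6]$ of type 2, i.e. such that the log matrix $A_F$ has a row with five entries equal to $1$.
   Context: $\mathbb{K}$ is a field. A monomial $f\in\mathbb{K}[x_1,\ldots,x_n]$ is square free if $x_i^2\nmid f$ for all $i$. For a set $F=\{f_1,\ldots,f_n\}$ of $n$ (distinct) monomials of the same degree $d$ in $\mathbb{K}[x_1,\ldots,x_n]$, the log matrix $A_F=(v_{ij})_{n\times n}$ is the matrix whose $j$-th column is the exponent vector of $f_j$, i.e. $f_j=x_1^{v_{1j}}\cdots x_n^{v_{nj}}$ (well defined up to permuting columns). $F$ is a square free set if all its monomials are square free. $F$ is a Cremona set if the rational map $\mathbb{P}^{n-1}\dashrightarrow\mathbb{P}^{n-1}$, $\underline{x}\mapsto(f_1(\underline{x}):\cdots:f_n(\underline{x}))$, is birational; algebraically, if $\mathbb{K}[f_1,\ldots,f_n]\subset \mathbb{K}[\underline{x}_d]$ becomes an equality at the level of fields of fractions, where $\mathbb{K}[\underline{x}_d]$ is the Veronese algebra generated by all monomials of degree $d$. The order of the elements of $F$ is irrelevant. $S_n$ acts on monomials by $\sigma*(x_1^{a_1}\cdots x_n^{a_n})=x_{\sigma(1)}^{a_1}\cdots x_{\sigma(n)}^{a_n}$ and on sets of monomials elementwise; two Cremona sets are equivalent if they lie in the same $S_n$-orbit. Here $n=6$, $d=3$. *)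

(* Defs.v *)
From HB Require Import structures.
From mathcomp Require Import all_boot all_order all_algebra all_fingroup.
From mathcomp Require Import fraction.
From mathcomp Require Import finmap.
From mathcomp Require Import mpoly.

Set Implicit Arguments.
Unset Strict Implicit.
Unset Printing Implicit Defensive.

Import GRing.Theory.

Local Open Scope ring_scope.
Local Open Scope fset_scope.

(* A monomial of K[x_1, ..., x_n] is represented by its exponent vector
   m : 'X_{1..n}; the corresponding polynomial is 'X_[K, m].  A set of monomials
   is a finite set of exponent vectors, so its elements are distinct and
   unordered. *)

(* U_(i) *+ 2 is the monomial x_i ^ 2, and (_ <= _)%MM is divisibility of
   monomials. *)
Definition squarefree_monomial n (m : 'X_{1..n}) : Prop :=
  forall i : 'I_n, ~~ (U_(i) *+ 2 <= m)%MM.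

Definition squarefree_set n (F : {fset 'X_{1..n}}) : Prop :=
  forall m, m \in F -> squarefree_monomial m.

(* The columns are taken in the order of the canonical enumeration of F; any
   other enumeration permutes the columns. *)
Definition log_matrix n (F : {fset 'X_{1..n}}) : 'M[nat]_(n, #|` F|) :=
  \matrix_(i < n, j < #|` F|) (nth 0%MM (enum_fset F) j) i.

(* The K-subalgebra K[S] of K[x_1, ..., x_n] generated by the monomials in S. *)
Inductive subalgebra (K : fieldType) n (S : 'X_{1..n} -> Prop) :
    {mpoly K[n]} -> Prop :=
  | subalgebra_const (c : K) : subalgebra S c%:MP
  | subalgebra_gen m : S m -> subalgebra S 'X_[m]
  | subalgebra_add p q :
      subalgebra S p -> subalgebra S q -> subalgebra S (p + q)
  | subalgebra_mul p q :
      subalgebra S p -> subalgebra S q -> subalgebra S (p * q).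

(* The field of fractions of a subring A of K[x_1, ..., x_n], as a subfield of
   K(x_1, ..., x_n). *)
Definition frac_field (K : fieldType) n (A : {mpoly K[n]} -> Prop)
    (z : {fraction {mpoly K[n]}}) : Prop :=
  exists p q : {mpoly K[n]},
    [/\ A p, A q, q != 0 & z = tofrac p / tofrac q].

(* The generators of the Veronese algebra K[x_d] are all the monomials of
   degree d. *)
Definition cremona_set (K : fieldType) n d (F : {fset 'X_{1..n}}) : Prop :=
  [/\ #|` F| = n,
      forall m, m \in F -> mdeg m = d
    & forall z : {fraction {mpoly K[n]}},
        frac_field (subalgebra (fun m => m \in F)) z <->
        frac_field (subalgebra (fun m => mdeg m = d)) z].

(* The exponent of x_(s i) in s * m is the exponent of x_i in m. *)
Definition perm_monomial n (s : 'S_n) (m : 'X_{1..n}) : 'X_{1..n} :=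
  [multinom m ((s^-1)%g j) | j < n].

Definition perm_set n (s : 'S_n) (F : {fset 'X_{1..n}}) : {fset 'X_{1..n}} :=
  [fset perm_monomial s m | m in F].

Definition equivalent_sets n (F G : {fset 'X_{1..n}}) : Prop :=
  exists s : 'S_n, G = perm_set s F.

Definition type2 n (F : {fset 'X_{1..n}}) : Prop :=
  exists i : 'I_n, #|[pred j | log_matrix F i j == 1%N]| = 5%N.

(* r is a complete, irredundant system of representatives, for the equivalence
   relation E, of the elements satisfying P. *)
Definition exactly_classes T (P : T -> Prop) (E : T -> T -> Prop) k : Prop :=
  exists r : 'I_k -> T,
    [/\ forall i, P (r i),
        forall i j, E (r i) (r j) -> i = j
      & forall x, P x -> exists i, E (r i) x].

(* Main.v *)
(* A set [F] is Cremona only if every nonempty set [C] of variables has odd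
   degree in some [f] of [F]: comparing supports in [x_j^3 q = p], with [j] in
   [C] and [p], [q] in [K[F]], gives a monomial of odd degree in [C] among the
   products of elements of [F].  For square free sets of type 2 this parity
   condition is also sufficient.  After a permutation of the variables, [F]
   consists of [x_3 x_4 x_5] and of the five [x_0 x_a x_b] with [ab] an edge of a
   graph on {1, ..., 5}; the graphs satisfying the parity condition are
   enumerated, and each is a copy of one of 20 representatives under a
   permutation that preserves {3, 4, 5}.

   Conversely, two edges with a common vertex give a ratio [x_a / x_b] in the
   fraction field of [K[F]].  For each representative these ratios generate all
   the [x_i / x_3] with [i] nonzero, hence [x_3^3], from [x_3 x_4 x_5], and
   finally [x_0 / x_3], from an edge.  The representatives are separated by an
   invariant computed from the degrees of the variables in [F]. *)
Require Import Defs.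
From mathcomp Require Import all_boot all_order all_algebra all_fingroup.
From mathcomp Require Import fraction finmap mpoly.

Set Implicit Arguments.
Unset Strict Implicit.
Unset Printing Implicit Defensive.

Import GRing.Theory.

Local Open Scope ring_scope.

(** * Subalgebras generated by monomials and their fraction fields *)

(** [P] cuts out a submonoid of exponent vectors, and sums and products of polynomials supported in
    a submonoid stay supported there. It serves below with [P] a parity condition. *)
Lemma subalgebra_msupp (K : fieldType) n (S P : 'X_{1..n} -> Prop) :
    P 0%MM -> (forall a b, P a -> P b -> P (a + b)%MM) ->
    (forall m, S m -> P m) ->
  forall p : {mpoly K[n]}, subalgebra S p -> forall m, m \in msupp p -> P m.
Proof.
move=> P0 PD SP p; elim=> {p} [c|m /SP Pm|p q _ IHp _ IHq|p q _ IHp _ IHq] m'.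
- by rewrite msuppC; case: ifP => // _; rewrite inE => /eqP ->.
- by move=> /mem_msuppXP <-.
- by move=> /msuppD_le; rewrite mem_cat => /orP [/IHp|/IHq].
- by move=> /msuppM_le /allpairsP [[a b] [/IHp Pa /IHq Pb ->]]; apply: PD.
Qed.

Lemma subalgebra_sub (K : fieldType) n (S T : 'X_{1..n} -> Prop) :
    (forall m, S m -> T m) ->
  forall p : {mpoly K[n]}, subalgebra S p -> subalgebra T p.
Proof.
move=> ST p; elim=> {p} [c|m Sm|p q _ IHp _ IHq|p q _ IHp _ IHq].
- exact: subalgebra_const.
- exact/subalgebra_gen/ST.
- exact: subalgebra_add.
- exact: subalgebra_mul.
Qed.

Section FracField.

Variables (K : fieldType) (n : nat) (S : 'X_{1..n} -> Prop).

Local Notation Frac := (frac_field (@subalgebra K n S)).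

Lemma frac_field_subalgebra p : subalgebra S p -> Frac (tofrac p).
Proof.
move=> Sp; exists p, 1; split=> //; first exact: (subalgebra_const S 1).
  exact: oner_neq0.
by rewrite tofrac1 divr1.
Qed.

Lemma frac_fieldM z w : Frac z -> Frac w -> Frac (z * w).
Proof.
case=> p [q [Sp Sq q0 ->]] [r [s [Sr Ss s0 ->]]].
exists (p * r), (q * s); split; [exact: subalgebra_mul..| |].
  by rewrite mulf_neq0.
by rewrite !tofracM mulf_div.
Qed.

Lemma frac_fieldD z w : Frac z -> Frac w -> Frac (z + w).
Proof.
case=> p [q [Sp Sq q0 ->]] [r [s [Sr Ss s0 ->]]].
exists (p * s + r * q), (q * s); split.
- by apply: subalgebra_add; apply: subalgebra_mul.
- exact: subalgebra_mul.
- by rewrite mulf_neq0.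
- by rewrite tofracD !tofracM addf_div // tofrac_eq0.
Qed.

Lemma frac_fieldV z : Frac z -> Frac z^-1.
Proof.
case=> p [q [Sp Sq q0 ->]]; have [->|p0] := eqVneq p 0.
  rewrite tofrac0 mul0r invr0 -tofrac0.
  exact/frac_field_subalgebra/(subalgebra_const S 0).
by exists q, p; split=> //; rewrite invf_div.
Qed.

Lemma frac_field_prod (I : finType) (P : pred I) (z : I -> {fraction {mpoly K[n]}}) :
  (forall i, P i -> Frac (z i)) -> Frac (\prod_(i | P i) z i).
Proof.
move=> Fz; apply: (big_ind Frac) => //; last exact: frac_fieldM.
rewrite -tofrac1; exact/frac_field_subalgebra/(subalgebra_const S 1).
Qed.

Lemma frac_fieldX z k : Frac z -> Frac (z ^+ k).
Proof. by move=> Fz; rewrite -[k]card_ord -prodr_const; apply: frac_field_prod. Qed.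

End FracField.

(** * A sufficient and a necessary condition for Cremona sets *)

Section Cremona.

Variables (K : fieldType) (n d : nat) (F : {fset 'X_{1..n}}).

(** One inclusion of fraction fields is automatic from the degrees. For the other, the fraction
    field of [K[F]] is closed under the field operations, so the generators of the Veronese algebra
    suffice. *)
Lemma cremona_set_of_frac :
    #|` F|%fset = n -> (forall m, m \in F -> mdeg m = d) ->
    (forall m, mdeg m = d ->
       frac_field (@subalgebra K n (fun m => m \in F)) (tofrac 'X_[m])) ->
  cremona_set K d F.
Proof.
move=> cardF degF FX; split=> // z; split.
  case=> p [q [Fp Fq q0 ->]]; exists p, q.
  by split=> //; apply: subalgebra_sub degF _ _.
have FA p : subalgebra (fun m => mdeg m = d) p ->
    frac_field (@subalgebra K n (fun m => m \in F)) (tofrac p).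
  elim=> {p} [c|m /FX //|p q _ Fp _ Fq|p q _ Fp _ Fq].
  - exact/frac_field_subalgebra/subalgebra_const.
  - by rewrite tofracD; apply: frac_fieldD.
  - by rewrite tofracM; apply: frac_fieldM.
by case=> p [q [/FA Fp /FA Fq q0 ->]]; apply/frac_fieldM/frac_fieldV.
Qed.

(* If all [f] in [F] had even degree in the variables of [C], so would every
   monomial of [K[F]], and the equation [p = x_j^d q] could not hold in [K[F]]
   for [j] in [C] and odd [d]. *)
Lemma cremona_set_odd (C : pred 'I_n) :
    cremona_set K d F -> odd d -> (exists j, C j) ->
  exists2 f, f \in F & odd (\sum_(i | C i) f i).
Proof.
case=> _ _ cremF odd_d [j Cj].
suff /hasP [f] : has (fun f : 'X_{1..n} => odd (\sum_(i | C i) f i)) F.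
  by exists f.
apply: contraT => /hasPn evenF.
pose even m := ~~ odd (\sum_(i < n | C i) (m : 'X_{1..n}) i).
have even_msupp p : @subalgebra K n (fun m => m \in F) p ->
    forall m, m \in msupp p -> even m.
  move=> Fp; apply: subalgebra_msupp Fp => [|a b ea eb|m /evenF //].
    by rewrite /even big1 // => i _; rewrite mnmE.
  rewrite /even (eq_bigr (fun i => (a i + b i)%N)) => [|i _]; last exact: mnmDE.
  by rewrite big_split oddD (negbTE ea) (negbTE eb).
pose x := (U_(j) *+ d)%MM.
have sum_x : (\sum_(i < n | C i) x i = d)%N.
  rewrite (bigD1 j) //= big1 => [|i /andP [_ /negbTE ij]].
    by rewrite addn0 mulmnE mnm1E eqxx mul1n.
  by rewrite mulmnE mnm1E eq_sym ij.
have [|p [q [Fp Fq q0 defX]]] := (cremF (tofrac 'X_[x])).2.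
  apply/frac_field_subalgebra/subalgebra_gen.
  by rewrite mdegMn mdeg1 mul1n.
have {defX} defp : p = q * 'X_[x].
  apply/eqP; rewrite -tofrac_eq tofracM defX mulrC divfK //.
  by rewrite tofrac_eq0.
(* Any monomial of [q] would do. Multiplying by ['X_[x]] shifts the support by [x], which has odd
   degree [d] in [C], so [p] and [q] cannot both be even. *)
have q_supp := mlead_supp q0; move: (even_msupp _ Fq _ q_supp).
have: even (x + mlead q)%MM.
  apply: (even_msupp _ Fp); rewrite defp (perm_mem (msuppMX q x)).
  exact: map_f.
rewrite /even (eq_bigr (fun i => (x i + mlead q i)%N)) => [|i _]; last exact: mnmDE.
by rewrite big_split oddD /= sum_x odd_d negbK => ->.
Qed.

End Cremona.

(** * The action of permutations of the variables *)

Section Permutations.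

Variable n : nat.
Implicit Types (s t : 'S_n) (m : 'X_{1..n}) (F : {fset 'X_{1..n}}).

Lemma perm_monomialE s m j : perm_monomial s m j = m ((s^-1)%g j).
Proof. exact: mnmE. Qed.

Lemma perm_monomialM s t m :
  perm_monomial (s * t)%g m = perm_monomial t (perm_monomial s m).
Proof. by apply/mnmP=> j; rewrite !perm_monomialE invMg permM. Qed.

Lemma perm_monomial1 m : perm_monomial 1%g m = m.
Proof. by apply/mnmP=> j; rewrite perm_monomialE invg1 perm1. Qed.

Lemma perm_monomial_inj s : injective (perm_monomial s).
Proof.
apply: (can_inj (g := perm_monomial s^-1%g)) => m.
by rewrite -perm_monomialM mulgV perm_monomial1.
Qed.

Lemma sum_perm_monomial s m (C : pred 'I_n) :
  (\sum_(i | C i) perm_monomial s m i = \sum_(i | C (s i)) m i)%N.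
Proof.
rewrite (reindex_inj (@perm_inj _ s)) /=; apply: eq_bigr => i _.
by rewrite perm_monomialE permK.
Qed.

Lemma mem_perm_set s F m : (perm_monomial s m \in perm_set s F) = (m \in F).
Proof. exact: (mem_imfset _ _ (@perm_monomial_inj s)). Qed.

Lemma perm_setP s F m :
  reflect (exists2 f, f \in F & m = perm_monomial s f) (m \in perm_set s F).
Proof. exact: imfsetP. Qed.

Lemma perm_setM s t F : perm_set (s * t)%g F = perm_set t (perm_set s F).
Proof.
apply/fsetP=> m; apply/perm_setP/perm_setP => [[f Ff ->]|[_ /perm_setP [f Ff ->] ->]].
  by exists (perm_monomial s f); rewrite ?mem_perm_set ?perm_monomialM.
by exists f; rewrite ?perm_monomialM.
Qed.

Lemma perm_set1 F : perm_set 1%g F = F.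
Proof.
apply/fsetP=> m; apply/perm_setP/idP => [[f Ff ->]|Fm].
  by rewrite perm_monomial1.
by exists m; rewrite ?perm_monomial1.
Qed.

Lemma perm_setK s F : perm_set s^-1%g (perm_set s F) = F.
Proof. by rewrite -perm_setM mulgV perm_set1. Qed.

Lemma card_perm_set s F : #|` perm_set s F|%fset = #|` F|%fset.
Proof. exact/card_imfset/perm_monomial_inj. Qed.

Lemma big_perm_set (R : Type) (idx : R) (op : Monoid.com_law idx) s F
    (G : 'X_{1..n} -> R) :
  \big[op/idx]_(m <- perm_set s F) G m
    = \big[op/idx]_(m <- F) G (perm_monomial s m).
Proof. by rewrite big_imfset //; exact: (in2W (@perm_monomial_inj s)). Qed.

Lemma perm_of_seq (q : seq nat) : perm_eq q (iota 0 n) ->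
  exists s, forall j, val (s j) = nth 0 q j.
Proof.
move=> pq; have sz_q : size q = n by rewrite (perm_size pq) size_iota.
have lt_q (j : 'I_n) : (nth 0 q j < n)%N.
  have: nth 0 q j \in q by rewrite mem_nth ?sz_q.
  by rewrite (perm_mem pq) mem_iota.
have inj_q : injective (fun j => Ordinal (lt_q j)).
  move=> i j /(congr1 val) /= /eqP; rewrite nth_uniq ?sz_q //.
    by move=> /eqP /val_inj.
  by rewrite (perm_uniq pq) iota_uniq.
by exists (perm inj_q) => j; rewrite permE.
Qed.

Lemma type2P F :
  type2 F <-> exists i, count (fun m : 'X_{1..n} => m i == 1%N) F = 5%N.
Proof.
suff cardE i : #|[pred j | log_matrix F i j == 1%N]|
    = count (fun m : 'X_{1..n} => m i == 1%N) F.
  by split=> -[i]; exists i; rewrite -?cardE // cardE.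
rewrite -sum1_card -sum1_count (big_nth 0%MM) big_mkord.
by apply: eq_bigl => j; rewrite !inE mxE.
Qed.

End Permutations.

Local Open Scope nat_scope.

(** * Square free monomials as bit sequences, and an invariant of sets of them *)

Fixpoint bitseqs k : seq bitseq :=
  if k is k'.+1 then
    [seq false :: b | b <- bitseqs k'] ++ [seq true :: b | b <- bitseqs k']
  else [:: [::]].

Lemma mem_bitseqs k b : (b \in bitseqs k) = (size b == k).
Proof.
elim: k b => [|k IHk] [|c b] //=; rewrite mem_cat.
  by apply/orP=> -[] /mapP [].
have inj_cons c' : injective (cons c' : bitseq -> bitseq) by move=> ? ? [].
rewrite eqSS -IHk; case: c; rewrite (mem_map (inj_cons _)).
  by rewrite orbC orb_idr // => /mapP [].
by rewrite orb_idr // => /mapP [].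
Qed.

Section Bits.

Variable n : nat.
Implicit Types (m : 'X_{1..n}) (b c : bitseq) (F : {fset 'X_{1..n}}).

Definition monb (b : bitseq) : 'X_{1..n} := [multinom nth false b i : nat | i < n].

Lemma monbE b i : monb b i = nth false b i.
Proof. exact: mnmE. Qed.

Lemma sum_iota (G : nat -> nat) : \sum_(i < n) G i = sumn [seq G i | i <- iota 0 n].
Proof. by rewrite sumnE big_map -[n in iota 0 n]subn0 big_mkord. Qed.

(** The length must be fixed: [monb] pads with the default [false] and ignores bits beyond [n]. *)
Lemma monb_inj : {in bitseqs n &, injective monb}.
Proof.
move=> b c; rewrite !mem_bitseqs => /eqP sb /eqP sc eq_bc.
apply: (@eq_from_nth _ false) => [|i]; rewrite sb ?sc // => lt_i.
move/mnmP: eq_bc => /(_ (Ordinal lt_i)).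
by rewrite !monbE /=; do 2!case: nth.
Qed.

Lemma squarefree_monb b : squarefree_monomial (monb b).
Proof.
move=> i; apply/mnm_lepP => /(_ i).
by rewrite mulmnE mnm1E eqxx monbE; case: nth.
Qed.

Definition bits_of (m : 'X_{1..n}) : bitseq :=
  [seq m i == 1 | i <- enum 'I_n].

Lemma nth_bits_of m (i : 'I_n) : nth false (bits_of m) i = (m i == 1).
Proof. by rewrite (nth_map i) ?size_enum_ord // nth_ord_enum. Qed.

Lemma bits_of_bitseqs m : bits_of m \in bitseqs n.
Proof. by rewrite mem_bitseqs size_map size_enum_ord. Qed.

Lemma squarefree_le1 m i : squarefree_monomial m -> m i <= 1.
Proof.
move=> /(_ i); apply: contraR; rewrite -ltnNge => gt1.
apply/mnm_lepP=> j; rewrite mulmnE mnm1E.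
by case: eqP => [<-|]; rewrite ?mul0n.
Qed.

Lemma bits_ofK m : squarefree_monomial m -> monb (bits_of m) = m.
Proof.
move=> sqm; apply/mnmP=> i; rewrite monbE nth_bits_of.
by case: (m i) (squarefree_le1 i sqm) => [|[]].
Qed.

Lemma mdeg_monb b : mdeg (monb b) = count (nth false b) (iota 0 n).
Proof.
rewrite mdegE -sumn_count -sum_iota; apply: eq_bigr => i _; by rewrite monbE.
Qed.

(** The list [q] tabulates the inverse of [s] because [perm_monomial] reads exponents through that
    inverse. *)
Lemma perm_monb (s : 'S_n) (q : seq nat) b :
    size q = n -> (forall j, val ((s^-1)%g j) = nth 0 q j) ->
  perm_monomial s (monb b) = monb [seq nth false b j | j <- q].
Proof.
move=> sz_q sq; apply/mnmP=> j.
by rewrite perm_monomialE !monbE sq (nth_map 0) ?sz_q.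
Qed.

Definition fset_bits (L : seq bitseq) : {fset 'X_{1..n}} :=
  [fset m in [seq monb b | b <- L]]%fset.

(** A finite set is enumerated in its own canonical order, so the list is recovered only up to
    permutation; sums and counts over the set can then be evaluated on [L]. *)
Lemma perm_fset_bits L : uniq L -> {subset L <= bitseqs n} ->
  perm_eq (fset_bits L) [seq monb b | b <- L].
Proof.
move=> uniqL Ln; apply: uniq_perm; first exact: fset_uniq.
  by rewrite map_inj_in_uniq // => b c /Ln bn /Ln cn; apply: monb_inj.
by move=> m; rewrite inE.
Qed.

Lemma fset_bitsP L m :
  reflect (exists2 b, b \in L & m = monb b) (m \in fset_bits L).
Proof. by rewrite inE; apply: mapP. Qed.

(* [A A^T] applied to [x], where [A] is the log matrix of [F]. *)
Definition gram (F : {fset 'X_{1..n}}) (x : 'I_n -> nat) i : nat :=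
  \sum_(f <- F) f i * \sum_j f j * x j.

Definition degree (F : {fset 'X_{1..n}}) i : nat := \sum_(f <- F) f i.

(* This pair was found by computer search; neither component alone separates
   the twenty classes. *)
Definition class_invariant F : nat * nat :=
  (\sum_(f <- F) \prod_i degree F i ^ (f : 'X_{1..n}) i,
   \sum_i gram F (degree F) i ^ 2).

Lemma degree_perm s F i : degree (perm_set s F) (s i) = degree F i.
Proof.
by rewrite /degree big_perm_set; apply: eq_bigr => f _; rewrite perm_monomialE permK.
Qed.

Lemma class_invariant_perm s F : class_invariant (perm_set s F) = class_invariant F.
Proof.
congr pair; rewrite ?big_perm_set.
  apply: eq_bigr => f _; rewrite (reindex_inj (@perm_inj _ s)) /=.
  by apply: eq_bigr => i _; rewrite degree_perm perm_monomialE permK.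
rewrite (reindex_inj (@perm_inj _ s)) /=; apply: eq_bigr => i _; congr (_ ^ _).
rewrite /gram big_perm_set; apply: eq_bigr => f _.
rewrite perm_monomialE permK; congr (_ * _).
rewrite (reindex_inj (@perm_inj _ s)) /=; apply: eq_bigr => j _.
by rewrite degree_perm perm_monomialE permK.
Qed.

Definition degreeb (L : seq bitseq) i := count (fun b => nth false b i) L.

Definition supportb (b : bitseq) := [seq i <- iota 0 n | nth false b i].

(** With exponents 0 and 1, powers become products over supports and factors [f i] become tests, so
    that [class_invariant] can be evaluated on lists. *)
Definition class_invariantb (L : seq bitseq) : nat * nat :=
  (sumn [seq foldr muln 1 [seq degreeb L i | i <- supportb b] | b <- L],
   sumn [seq sumn [seq (if nth false b i then
                         sumn [seq degreeb L j | j <- supportb b] else 0)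
                  | b <- L] ^ 2 | i <- iota 0 n]).

Lemma class_invariant_bits L : uniq L -> {subset L <= bitseqs n} ->
  class_invariant (fset_bits L) = class_invariantb L.
Proof.
move=> uL Ln; have pL := perm_fset_bits uL Ln.
have degE i : degree (fset_bits L) i = degreeb L i.
  rewrite /degree (perm_big _ pL) big_map /degreeb -sumn_count sumnE big_map.
  by apply: eq_bigr => b _; rewrite monbE.
congr pair.
  rewrite (perm_big _ pL) big_map sumnE big_map; apply: eq_bigr => b _.
  rewrite foldrE big_map big_filter.
  rewrite -[n in iota 0 n]subn0 big_mkord [RHS]big_mkcond /=.
  by apply: eq_bigr => i _; rewrite degE monbE; case: nth.
apply: etrans (sum_iota _); apply: eq_bigr => i _; congr (_ ^ _).
rewrite /gram (perm_big _ pL) big_map sumnE big_map; apply: eq_bigr => b _.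
rewrite monbE; case: nth; rewrite ?mul0n // mul1n sumnE big_map big_filter.
rewrite -[n in iota 0 n]subn0 big_mkord [RHS]big_mkcond /=.
by apply: eq_bigr => j _; rewrite degE monbE; case: nth; rewrite ?mul1n ?mul0n.
Qed.

End Bits.

(** * Cremona sets from ratios of variables *)

Section Ratios.

Local Open Scope ring_scope.

Variables (K : fieldType) (n d : nat) (F : {fset 'X_{1..n}}) (c i0 : 'I_n).

Local Notation Frac := (frac_field (@subalgebra K n (fun m => m \in F))).
Local Notation ratio i j := (tofrac ('X_i : {mpoly K[n]}) / tofrac 'X_j).

Lemma tofracX_neq0 (i : 'I_n) : tofrac ('X_i : {mpoly K[n]}) != 0.
Proof. by rewrite tofrac_eq0 -msupp_eq0 msuppX. Qed.

(** Dehomogenization at [c]: each variable is ['X_c] times a ratio, and the factors ['X_c] add up to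
    the degree. *)
Lemma tofrac_monomial m :
  tofrac ('X_[m] : {mpoly K[n]})
    = tofrac 'X_c ^+ mdeg m * \prod_i ratio i c ^+ m i.
Proof.
rewrite mpolyXE_id rmorph_prod mdegE -prodrXr -big_split /=.
by apply: eq_bigr => i _; rewrite tofracXn -exprMn mulrC divfK // tofracX_neq0.
Qed.

Lemma cremona_set_of_ratios t f :
    #|` F|%fset = n -> (forall m, m \in F -> mdeg m = d) ->
    t \in F -> t i0 = 0%N -> f \in F -> f i0 = 1%N ->
    (forall i, i != i0 -> Frac (ratio i c)) ->
  cremona_set K d F.
Proof.
move=> cardF degF Ft ti0 Ff fi0 Fr; apply: cremona_set_of_frac => // m degm.
have FX (g : 'X_{1..n}) : g \in F -> Frac (tofrac 'X_[g]).
  by move=> Fg; apply/frac_field_subalgebra/subalgebra_gen.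
have Fprod (g : 'X_{1..n}) : Frac (\prod_(i | i != i0) ratio i c ^+ g i).
  by apply: frac_field_prod => i /Fr; apply: frac_fieldX.
have r_neq0 i : ratio i c != 0 by rewrite mulf_neq0 ?invr_eq0 ?tofracX_neq0.
have prod_neq0 (g : 'X_{1..n}) : \prod_(i | i != i0) ratio i c ^+ g i != 0.
  by apply/prodf_neq0 => i _; apply: expf_neq0.
(* Since [t] avoids [i0], dividing it by known ratios leaves the power of ['X_c]. *)
have Fcd : Frac (tofrac 'X_c ^+ d).
  have := tofrac_monomial t; rewrite (bigD1 i0) //= ti0 mul1r degF //.
  move=> /(canLR (mulfK (prod_neq0 t))) <-.
  by apply: frac_fieldM; [exact: FX | apply: frac_fieldV].
have cd_neq0 : tofrac ('X_c : {mpoly K[n]}) ^+ d != 0.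
  exact/expf_neq0/tofracX_neq0.
(* Since [f] has exponent 1 at [i0], the missing ratio is its only unknown factor. *)
have Fr0 : Frac (ratio i0 c).
  have := tofrac_monomial f; rewrite (bigD1 i0) //= fi0 expr1 degF //.
  rewrite mulrA => /(canLR (mulfK (prod_neq0 f))).
  rewrite [_ ^+ d * _]mulrC => /(canLR (mulfK cd_neq0)) <-.
  apply: frac_fieldM; last exact: frac_fieldV.
  by apply: frac_fieldM; [exact: FX | apply: frac_fieldV].
rewrite tofrac_monomial degm; apply: frac_fieldM => //.
apply: frac_field_prod => i _; apply: frac_fieldX.
by have [->|/Fr] := eqVneq i i0.
Qed.

End Ratios.

(** * The twenty representatives *)

Definition code (s : seq nat) : bitseq := [seq i \in s | i <- iota 0 6].

Definition edge_code (e : nat * nat) : bitseq := code [:: 0; e.1; e.2].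

Definition hub_codes (E : seq (nat * nat)) : seq bitseq :=
  code [:: 3; 4; 5] :: [seq edge_code e | e <- E].

Definition hub_edges : seq (nat * nat) :=
  [:: (1, 2); (1, 3); (1, 4); (1, 5); (2, 3);
      (2, 4); (2, 5); (3, 4); (3, 5); (4, 5)].

(** Completeness of this list is checked in [odd_hub_system_covered], irredundancy in [rep_inj]. *)
Definition representatives : seq (seq (nat * nat)) :=
  [:: [:: (1, 2); (1, 3); (1, 4); (1, 5); (2, 3)];
      [:: (1, 2); (1, 3); (1, 4); (1, 5); (3, 4)];
      [:: (1, 2); (1, 3); (1, 4); (2, 3); (2, 5)];
      [:: (1, 2); (1, 3); (1, 4); (2, 3); (3, 5)];
      [:: (1, 2); (1, 3); (1, 4); (2, 3); (4, 5)];
      [:: (1, 2); (1, 3); (1, 4); (2, 5); (3, 4)];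
      [:: (1, 2); (1, 3); (1, 4); (3, 4); (3, 5)];
      [:: (1, 2); (1, 3); (2, 3); (3, 4); (3, 5)];
      [:: (1, 2); (1, 3); (2, 3); (3, 4); (4, 5)];
      [:: (1, 2); (1, 3); (2, 4); (3, 5); (4, 5)];
      [:: (1, 2); (1, 3); (3, 4); (3, 5); (4, 5)];
      [:: (1, 3); (1, 4); (1, 5); (2, 3); (3, 4)];
      [:: (1, 3); (1, 4); (1, 5); (2, 3); (4, 5)];
      [:: (1, 3); (1, 4); (2, 3); (2, 5); (3, 4)];
      [:: (1, 3); (1, 4); (2, 3); (2, 5); (4, 5)];
      [:: (1, 3); (1, 4); (2, 3); (3, 4); (3, 5)];
      [:: (1, 3); (1, 4); (2, 3); (3, 4); (4, 5)];
      [:: (1, 3); (1, 4); (2, 5); (3, 4); (3, 5)];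
      [:: (1, 3); (2, 3); (3, 4); (3, 5); (4, 5)];
      [:: (1, 3); (2, 4); (3, 4); (3, 5); (4, 5)]].

Definition rep_codes (k : 'I_20) := hub_codes (nth [::] representatives k).

Definition rep (k : 'I_20) : {fset 'X_{1..6}} := fset_bits 6 (rep_codes k).

(* [x_i / x_j = f / g] for some [f] and [g] in [L]. *)
Definition linked (L : seq bitseq) (i j : nat) : bool :=
  has (fun f => has (fun g =>
    all (fun k => nth false f k + (k == j) == nth false g k + (k == i)) (iota 0 6))
    L) L.

(** Breadth-first search along links; the disjunct [i == j] keeps what was already found. *)
Definition reachable (L : seq bitseq) (c k : nat) : seq nat :=
  iter k (fun S => [seq i <- iota 0 6 | has (fun j => (i == j) || linked L i j) S])
    [:: c].

Lemma reachable_ratio (K : fieldType) (L : seq bitseq) (c i : 'I_6) k :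
    val i \in reachable L c k ->
  frac_field (@subalgebra K 6 (fun m => m \in fset_bits 6 L))
    (tofrac 'X_i / tofrac 'X_c)%R.
Proof.
rewrite /reachable; elim: k i => [|k IHk] i.
  rewrite inE => /eqP /val_inj ->; rewrite divff ?tofracX_neq0 // -tofrac1.
  exact/frac_field_subalgebra/(subalgebra_const _ 1).
rewrite iterS; set S := iter _ _ _ in IHk *; rewrite mem_filter => /andP [/hasP [j' Sj] ij _].
have lt_j : j' < 6.
  move: Sj; rewrite /S; case: (k) => [|k']; first by rewrite inE => /eqP ->.
  by rewrite iterS mem_filter mem_iota => /and3P [].
pose j := Ordinal lt_j; have {}ij : (i == j) || linked L i j by [].
have /IHk Fj : val j \in S by [].
case/orP: ij => [/eqP -> //|/hasP [f Lf /hasP [g Lg /allP fg]]].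
(* The ratio to [c] factors through [j]: a link, equal to a quotient of two elements of the set,
   times a ratio known by induction. *)
rewrite -[tofrac 'X_i](divfK (tofracX_neq0 _ j)) -[(_ * tofrac 'X_j / _)%R]mulrA.
apply: frac_fieldM => //.
have Xfg : (tofrac ('X_[monb 6 f] : {mpoly K[6]}) * tofrac 'X_j)%R
    = (tofrac 'X_[monb 6 g] * tofrac 'X_i)%R.
  rewrite -!tofracM -!mpolyXD; congr (tofrac 'X_[_]); apply/mnmP=> k0.
  rewrite !mnmDE !monbE !mnm1E ![_ == k0]eq_sym.
  by apply/eqP/fg; rewrite mem_iota ltn_ord.
have FX h : h \in L -> frac_field (@subalgebra K 6 (fun m => m \in fset_bits 6 L))
    (tofrac 'X_[monb 6 h]).
  move=> Lh; apply/frac_field_subalgebra/subalgebra_gen/fset_bitsP.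
  by exists h.
have -> : (tofrac ('X_i : {mpoly K[6]}) / tofrac 'X_j
    = tofrac 'X_[monb 6 f] / tofrac 'X_[monb 6 g])%R.
  have g_neq0 : tofrac ('X_[monb 6 g] : {mpoly K[6]}) != 0%R.
    by rewrite tofrac_eq0 -msupp_eq0 msuppX.
  by apply/eqP; rewrite (eqr_div _ _ (tofracX_neq0 K j) g_neq0) Xfg mulrC.
by apply: frac_fieldM; [exact: FX | exact/frac_fieldV/FX].
Qed.

(** A computable certificate for the hypotheses of [cremona_set_of_ratios] with [i0] the variable 0,
    [c] the variable 3 and [t] the head of [L]. Five rounds suffice, as a shortest chain among six
    variables has at most five links. *)
Definition rep_ok (L : seq bitseq) : bool :=
  [&& uniq L, size L == 6,
      all (fun b => (size b == 6) && (count (nth false b) (iota 0 6) == 3)) L,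
      count (fun b => nth false b 0) L == 5,
      ~~ nth false (head [::] L) 0 &
      all (fun i => i \in reachable L 3 5) (iota 1 5)].

Section RepOk.

Variables (L : seq bitseq) (L_ok : rep_ok L).

Lemma rep_ok_bitseqs : {subset L <= bitseqs 6}.
Proof.
case/and5P: L_ok => _ _ /allP L6 _ _ b /L6 /andP [/eqP b6 _].
by rewrite mem_bitseqs b6.
Qed.

Lemma rep_ok_perm : perm_eq (fset_bits 6 L) [seq monb 6 b | b <- L].
Proof. by case/andP: L_ok => uL _; apply/perm_fset_bits/rep_ok_bitseqs. Qed.

Lemma rep_ok_type2 : type2 (fset_bits 6 L).
Proof.
apply/type2P; exists ord0; rewrite (seq.permP rep_ok_perm) count_map.
case/and5P: L_ok => _ _ _ /eqP count0 _; rewrite -[RHS]count0.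
by apply: eq_count => b /=; rewrite monbE eqb1.
Qed.

Lemma rep_ok_cremona (K : fieldType) : cremona_set K 3 (fset_bits 6 L).
Proof.
case/and5P: L_ok => uL /eqP size6 /allP deg3 /eqP count0 /andP [t0 reach].
have memF b : b \in L -> monb 6 b \in fset_bits 6 L.
  by move=> Lb; apply/fset_bitsP; exists b.
have /hasP [f Lf f0] : has (fun b => nth false b 0) L by rewrite has_count count0.
have Lt : head [::] L \in L by case: (L) size6 => // t L' _; apply: mem_head.
apply: (@cremona_set_of_ratios K 6 3 _ (inord 3) ord0
          (monb 6 (head [::] L)) (monb 6 f)).
- by rewrite (perm_size rep_ok_perm) size_map.
- by move=> m /fset_bitsP [b /deg3 /andP [_ /eqP b3] ->]; rewrite mdeg_monb.
- exact: memF.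
- by rewrite monbE (negbTE t0).
- exact: memF.
- by rewrite monbE f0.
move=> i i0; apply: (@reachable_ratio K _ _ i 5); rewrite inordK //.
by apply: (allP reach); rewrite mem_iota ltn_ord andbT lt0n.
Qed.

End RepOk.

Lemma rep_codes_ok k : rep_ok (rep_codes k).
Proof.
have /allP all_ok : all (rep_ok \o hub_codes) representatives.
  by vm_cast_no_check (erefl true).
exact/all_ok/mem_nth.
Qed.

Lemma rep_inj i j : equivalent_sets (rep i) (rep j) -> i = j.
Proof.
pose inv E := class_invariantb 6 (hub_codes E).
(* Evaluation shows the twenty values of the invariant to be pairwise distinct. *)
have inv_uniq : uniq [seq inv E | E <- representatives].
  by vm_cast_no_check (erefl true).
have repE (k : 'I_20) :
    class_invariant (rep k) = nth (0, 0) [seq inv E | E <- representatives] k.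
  rewrite (nth_map [::] (0, 0) inv (ltn_ord k : k < size representatives)).
  have ok := rep_codes_ok k; have [uniqL _] := andP ok.
  exact: class_invariant_bits uniqL (rep_ok_bitseqs ok).
case=> s rep_s; apply/val_inj/eqP.
rewrite -(nth_uniq (0, 0) _ _ inv_uniq) ?size_map; try exact: ltn_ord.
by rewrite -!repE rep_s class_invariant_perm.
Qed.

(** * Normal form of type 2 sets: a hub and a graph *)

Lemma squarefree_perm n (s : 'S_n) (m : 'X_{1..n}) :
  squarefree_monomial m -> squarefree_monomial (perm_monomial s m).
Proof.
move=> sqm; rewrite -(bits_ofK sqm) => i; apply/mnm_lepP => /(_ i).
by rewrite mulmnE mnm1E eqxx perm_monomialE monbE; case: nth.
Qed.

Definition permute_bits (q : seq nat) (b : bitseq) : bitseq :=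
  [seq nth false b j | j <- q].

(** For [i] the variable shared by five monomials and [b] the sixth monomial, this relabelling
    brings [i] to position 0 and the variables of [b] to positions 3, 4, 5. *)
Definition hub_order (b : bitseq) (i : nat) : seq nat :=
  i :: [seq j <- iota 0 6 | (j != i) && ~~ nth false b j]
    ++ [seq j <- iota 0 6 | nth false b j].

Definition hub_order_ok (b : bitseq) (i : nat) : bool :=
  [|| count (nth false b) (iota 0 6) != 3, nth false b i |
      perm_eq (hub_order b i) (iota 0 6)
      && (permute_bits (hub_order b i) b == code [:: 3; 4; 5])].

Lemma hub_orderP b (i : 'I_6) : b \in bitseqs 6 -> hub_order_ok b i.
Proof.
move=> b6; have lt_i : val i \in iota 0 6 by rewrite mem_iota ltn_ord.
have /allP /(_ b b6) /allP : all (fun b => all (hub_order_ok b) (iota 0 6)) (bitseqs 6).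
  by vm_cast_no_check (erefl true).
exact.
Qed.

Definition edge_code_ok (b : bitseq) : bool :=
  [|| count (nth false b) (iota 0 6) != 3, ~~ nth false b 0 |
      b \in [seq edge_code e | e <- hub_edges]].

Lemma edge_codeP b : b \in bitseqs 6 -> edge_code_ok b.
Proof.
apply: (allP (_ : all edge_code_ok (bitseqs 6))).
by vm_cast_no_check (erefl true).
Qed.

Lemma hub_codes_uniq : uniq (hub_codes hub_edges).
Proof. by vm_cast_no_check (erefl true). Qed.

Lemma hub_codes_bitseqs E : {subset hub_codes E <= bitseqs 6}.
Proof.
by move=> b; rewrite mem_bitseqs inE => /orP [/eqP ->|/mapP [e _ ->]];
  rewrite size_map size_iota.
Qed.

(** Five of the six elements have exponent 1 at [i], so the filtered list of the others is a
    singleton. *)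
Lemma type2_exception (F : {fset 'X_{1..6}}) :
    #|` F|%fset = 6 -> type2 F ->
  exists i, exists2 t, t \in F &
    t i != 1 /\ forall m, m \in F -> m != t -> m i = 1.
Proof.
move=> cardF /type2P [i count5]; exists i.
have := count_predC (fun m : 'X_{1..6} => m i == 1) F.
rewrite count5 [size _]cardF => /eqP; rewrite (eqn_add2l 5 _ 1) -size_filter.
set others := filter _ _ => /eqP size_others.
have othersE m : (m \in others) = (m i != 1) && (m \in F) by rewrite mem_filter.
case: others size_others othersE => [|t [|]] // _ othersE.
have := othersE t; rewrite mem_head => /esym /andP [ti Ft].
exists t => //; split=> // m Fm; apply: contra_neq_eq => mi.
by apply/eqP; rewrite -mem_seq1 othersE mi.
Qed.

Lemma type2_hub (F : {fset 'X_{1..6}}) :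
    squarefree_set F -> (forall m, m \in F -> mdeg m = 3) ->
    #|` F|%fset = 6 -> type2 F ->
  exists (s : 'S_6) (b : bitseq),
    [/\ size b = 10, size (mask b hub_edges) = 5
      & perm_set s F = fset_bits 6 (hub_codes (mask b hub_edges))].
Proof.
move=> sqF deg3 cardF /(type2_exception cardF) [i [t Ft [ti others_i]]].
have count3 (m : 'X_{1..6}) : squarefree_monomial m -> mdeg m = 3 ->
    count (nth false (bits_of m)) (iota 0 6) = 3.
  by move=> sqm m3; rewrite -mdeg_monb bits_ofK.
have := hub_orderP i (bits_of_bitseqs t); rewrite /hub_order_ok.
set q := hub_order _ _; case/or3P=> [|| /andP [perm_q /eqP t_q]].
- by rewrite count3 ?eqxx //; [apply: sqF | apply: deg3].
- by rewrite nth_bits_of (negbTE ti).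
have [s0 s0_q] := perm_of_seq perm_q.
have size_q : size q = 6 by rewrite (perm_size perm_q) size_iota.
pose s := (s0^-1)%g; pose G := perm_set s F.
have s_t : perm_monomial s t = monb 6 (code [:: 3; 4; 5]).
  rewrite -(bits_ofK (sqF _ Ft)) (perm_monb (q := q)) //; last by rewrite invgK.
  by rewrite -t_q.
have G_cases m : m \in G ->
    m = monb 6 (code [:: 3; 4; 5]) \/
    exists2 e, e \in hub_edges & m = monb 6 (edge_code e).
  case/perm_setP => f Ff ->; have [->|neq_ft] := eqVneq f t; first by left.
  right; set m' := perm_monomial s f.
  have sqm : squarefree_monomial m' by apply/squarefree_perm/sqF.
  have m3 : mdeg m' = 3.
    by rewrite -[RHS](deg3 _ Ff) !mdegE (sum_perm_monomial s f xpredT).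
  have := edge_codeP (bits_of_bitseqs m'); rewrite /edge_code_ok.
  case/or3P=> [||/mapP [e e_edge def_m']]; last first.
  - by exists e; rewrite // -def_m' bits_ofK.
  - rewrite (nth_bits_of m' ord0) perm_monomialE invgK.
    have -> : s0 ord0 = i by apply: val_inj; rewrite s0_q.
    by rewrite (others_i _ Ff neq_ft).
  - by rewrite count3 ?eqxx.
(* Recording the edges as a mask of [hub_edges] makes the set one of 1024 candidates. *)
pose b := [seq monb 6 (edge_code e) \in G | e <- hub_edges].
have GE : G = fset_bits 6 (hub_codes (mask b hub_edges)).
  apply/fsetP=> m; rewrite /b -filter_mask; apply/idP/fset_bitsP => [Gm|[c]].
    case: (G_cases m Gm) => [->|[e e_edge def_m]].
      by exists (code [:: 3; 4; 5]); rewrite ?mem_head.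
    exists (edge_code e) => //; rewrite inE; apply/orP; right; apply: map_f.
    by rewrite mem_filter e_edge andbT -def_m.
  rewrite inE => /orP [/eqP ->|/mapP [e]].
    by move=> ->; rewrite -s_t mem_perm_set.
  by rewrite mem_filter => /andP [Ge _] -> ->.
have uniqE : uniq (hub_codes (mask b hub_edges)).
  apply: subseq_uniq hub_codes_uniq.
  apply: (cat_subseq (subseq_refl [:: code [:: 3; 4; 5]])).
  exact/map_subseq/mask_subseq.
exists s, b; split=> //.
have : #|` G|%fset = (size (mask b hub_edges)).+1.
  rewrite GE [LHS](perm_size (perm_fset_bits uniqE (@hub_codes_bitseqs _))).
  by rewrite size_map -(size_map edge_code).
by rewrite card_perm_set cardF => -[].
Qed.

(** * The parity condition and the enumeration of graphs *)

Definition meets_oddly (L : seq bitseq) (C : bitseq) : bool :=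
  has (fun b => odd (count (fun i => nth false C i && nth false b i) (iota 0 6))) L.

(** Over the field with two elements, no nonzero row vector [C] annihilates the matrix with columns
    [L]; for six monomials, the determinant is odd. *)
Definition odd_system (L : seq bitseq) : bool :=
  all (fun C => ~~ has id C || meets_oddly L C) (bitseqs 6).

Lemma odd_systemP (L : seq bitseq) :
    (forall C : pred 'I_6, (exists j, C j) ->
       exists2 f, f \in fset_bits 6 L & odd (\sum_(i | C i) f i)) ->
  odd_system L.
Proof.
move=> oddL; apply/allP=> C; rewrite mem_bitseqs => /eqP size_C.
have [/hasP [c Cc c1]|//] := boolP (has id C).
have [|_ /fset_bitsP [b Lb ->] odd_b] := oddL (fun i => nth false C i).
  have lt_c : index c C < 6 by rewrite -size_C index_mem.
  by exists (Ordinal lt_c); rewrite /= nth_index.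
apply/hasP; exists b => //; move: odd_b; congr (is_true (odd _)).
rewrite -sumn_count -(sum_iota 6) big_mkcond /=; apply: eq_bigr => i _.
by rewrite monbE; case: nth.
Qed.

(** The twelve permutations that fix the hub 0 and the monomial on 3, 4, 5. *)
Definition hub_perms : seq (seq nat) :=
  [seq 0 :: p ++ q | p <- permutations [:: 1; 2], q <- permutations [:: 3; 4; 5]].

(** The [if], unlike a conjunction, spares call-by-value evaluation the parity test on edge sets of
    the wrong size. *)
Definition odd_hub_systems : seq (seq (nat * nat)) :=
  [seq E <- [seq mask b hub_edges | b <- bitseqs 10] |
     if size E == 5 then odd_system (hub_codes E) else false].

(** Inclusion is enough, since the sets compared later have equal cardinality. *)
Definition covers (E R : seq (nat * nat)) (q : seq nat) : bool :=
  all (fun c => permute_bits q c \in hub_codes E) (hub_codes R).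

Lemma odd_hub_system_covered :
  all (fun E => has (fun R => has (covers E R) hub_perms) representatives)
    odd_hub_systems.
Proof. by vm_cast_no_check (erefl true). Qed.

Lemma hub_perms_perm q : q \in hub_perms -> perm_eq q (iota 0 6).
Proof.
apply: (allP (_ : all (fun q => perm_eq q (iota 0 6)) hub_perms)).
by vm_cast_no_check (erefl true).
Qed.

Lemma odd_type2_equivalent_rep (F : {fset 'X_{1..6}}) :
    squarefree_set F -> (forall m, m \in F -> mdeg m = 3) ->
    #|` F|%fset = 6 -> type2 F ->
    (forall C : pred 'I_6, (exists j, C j) ->
       exists2 f, f \in F & odd (\sum_(i | C i) f i)) ->
  exists k, equivalent_sets (rep k) F.
Proof.
move=> sqF deg3 cardF t2F oddF.
have [s [b [size_b size_E GE]]] := type2_hub sqF deg3 cardF t2F.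
move: GE size_E; set E := mask b hub_edges => GE size_E.
have odd_E : odd_system (hub_codes E).
  apply: odd_systemP => C [j Cj].
  have [|f Ff] := oddF (fun i => C (s i)); first by exists ((s^-1)%g j); rewrite permKV.
  by exists (perm_monomial s f); rewrite -?GE ?mem_perm_set ?sum_perm_monomial.
have odd_hub_E : E \in odd_hub_systems.
  rewrite mem_filter size_E eqxx odd_E; apply/mapP; exists b => //.
  by rewrite mem_bitseqs size_b.
have /hasP [R R_rep /hasP [q /hub_perms_perm perm_q /allP cov]] :=
  allP odd_hub_system_covered E odd_hub_E.
have lt_k : index R representatives < 20 by rewrite index_mem.
pose k : 'I_20 := Ordinal lt_k.
have rep_k : rep_codes k = hub_codes R by rewrite /rep_codes nth_index.
have [s0 s0_q] := perm_of_seq perm_q.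
have size_q : size q = 6 by rewrite (perm_size perm_q) size_iota.
(* The first factor carries [rep k] to the normal form of [F], the second undoes the
   normalization. *)
exists k, (s0^-1 * s^-1)%g; rewrite perm_setM.
suff -> : perm_set s0^-1 (rep k) = perm_set s F by rewrite perm_setK.
apply/eqP; rewrite eqEfcard !card_perm_set cardF; apply/andP; split; last first.
  (* Only the cardinality of [rep k] is wanted, so any field serves; [bool] is the field with two
     elements. *)
  by have [->] := rep_ok_cremona (rep_codes_ok k) bool.
apply/fsubsetP=> _ /perm_setP [_ /fset_bitsP [c Lc ->] ->].
rewrite GE (perm_monb (q := q)) //; last by rewrite invgK.
by apply/fset_bitsP; exists (permute_bits q c); rewrite // cov // -rep_k.
Qed.

Theorem proposition19 (K : fieldType) :
  exactly_classes
    (fun F : {fset 'X_{1..6}} =>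
       [/\ squarefree_set F, cremona_set K 3 F & type2 F])
    (@equivalent_sets 6) 20.
Proof.
exists rep; split.
- move=> k; have ok := rep_codes_ok k; split.
  + by move=> m /fset_bitsP [b _ ->]; apply: squarefree_monb.
  + exact: rep_ok_cremona.
  + exact: rep_ok_type2.
- exact: rep_inj.
- move=> F [sqF cremF t2F]; have [cardF deg3 _] := cremF.
  apply: odd_type2_equivalent_rep => // C; exact: cremona_set_odd cremF _.
Qed.
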